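(* Let $L$ be a finite geometric lattice with a sheaf $F$, let $B=\widetilde L$ be its Boolean cover (with the induced sheaf $F$), and let $a$ be an atom of $L$. Let $B^a=\{x\in B: a\in x\}$, regarded as a Boolean lattice with atoms $\{a,b\}$ for $b\ne a$ (via the isomorphism $x\mapsto x\setminus\{a\}$ with the Boolean lattice of subsets of $A\setminus\{a\}$), with the restriction of $F$. Let $L^a=\{x\in L:x\ge a\}$ be the restriction and $\widetilde{L^a}$ its Boolean cover with induced sheaf $F$. Then for all $i$, $$\mathrm{HC}_i(B^a;F)\cong\mathrm{HC}_i(\widetilde{L^a};F).$$
   Context: A finite lattice is geometric if it is graded (rank function $rk$, $rk(\mathbf{0})=0$), atomic (every element is a join of rank-$1$ elements, called atoms; the empty join is $\mathbf{0}$), and $rk(x\vee y)+rk(x\wedge y)\le rk(x)+rk(y)$. $A$ denotes the set of atoms of $L$. $L^a$ is a graded atomic lattice with minimum $a$ whose atoms are the elements covering $a$. A sheaf $F$ on a poset assigns an $R$-module $F(x)$ to each element and a homomorphism $F^y_x:F(y)\to F(x)$ to each $x\le y$, functorially. Boolean cover of a graded atomic lattice $M$ with atoms $A_M$: the lattice $\widetilde M$ of subsets of $A_M$ under inclusion with $f:\widetilde M\to M$, $S\mapsto$ join of $S$ in $M$ ($\varnothing\mapsto\min M$); a sheaf $G$ on $M$ induces $G(S)=G(f(S))$ with maps $G^{f(T)}_{f(S)}$. Cellular homology of a Boolean lattice of subsets of $\{a_1,\dots,a_n\}$ with sheaf $G$: $C_k=\bigoplus_{|x|=k}G(x)$, $d=\sum\varepsilon^x_yG^x_y$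 over $y\subset x$, $|y|=|x|-1$, $\varepsilon^x_y=(-1)^{j-1}$ if $x=\{a_{i_1},\dots,a_{i_k}\}$ ($i_1<\cdots<i_k$), $y=x\setminus\{a_{i_j}\}$; $\mathrm{HC}_*$ its homology (independent of the ordering up to isomorphism). *)

(* Defs.v *)
From HB Require Import structures.
From mathcomp Require Import all_boot all_order all_algebra.
Unset Printing Implicit Defensive.
Import Order.Theory GRing.Theory.

Local Open Scope order_scope.

Section Lattice.
Context {disp : Order.disp_t} {L : finTBLatticeType disp}.

Definition covers (x y : L) : bool :=
  (x < y) && [forall z : L, ~~ ((x < z) && (z < y))].

Definition atomb (x : L) : bool := covers \bot x.

Definition geometric (rk : L -> nat) : Prop :=
  [/\ rk \bot = 0%N,
      (forall x y : L, covers x y -> rk y = (rk x).+1),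
      (forall x : L, x = \join_(p | atomb p && (p <= x)) p) &
      (forall x y : L, (rk (x `|` y) + rk (x `&` y) <= rk x + rk y)%N)].

Definition is_sheaf {R : nzRingType} (F : L -> lmodType R)
    (res : forall x y : L, {linear F y -> F x}) : Prop :=
  (forall x (v : F x), res x x v = v) /\
  (forall x y z (v : F z), x <= y -> y <= z -> res x y (res y z v) = res x z v).

End Lattice.

Local Close Scope order_scope.
Local Open Scope ring_scope.

(* Cellular chain complex of the Boolean lattice of subsets of I, with sheaf
   G (G S) and restriction maps g S T : G T -> G S (used for S \subset T).
   A chain of total degree is a dependent function; the degree-k part of the
   complex C_k = (+)_{|x|=k} G x consists of the chains supported on |x| = k. *)
Section Boolean.
Variables (R : nzRingType) (I : finType) (G : {set I} -> lmodType R)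
          (g : forall S T : {set I}, G T -> G S).

Definition chain := forall x : {set I}, G x.

(* eps^x_{x \ {i}} = (-1)^(j-1), j-1 = number of elements of x before i
   (atoms ordered by enum_rank) *)
Definition eps (x : {set I}) (i : I) : R :=
  (-1) ^+ #|[set j in x | (nat_of_ord (enum_rank j) < nat_of_ord (enum_rank i))%N]|.

Definition bdry (c : chain) : chain := fun y =>
  \sum_(i | i \notin y) eps (i |: y) i *: g y (i |: y) (c (i |: y)).

Definition homog (k : nat) (c : chain) : Prop :=
  forall x : {set I}, #|x| != k -> c x = 0.

Definition cyc (k : nat) (c : chain) : Prop :=
  homog k c /\ forall y, bdry c y = 0.

Definition bnd (k : nat) (c : chain) : Prop :=
  exists e : chain, homog k.+1 e /\ forall y, c y = bdry e y.

Definition csub (c1 c2 : chain) : chain := fun x => c1 x - c2 x.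
Definition clin (r : R) (c1 c2 : chain) : chain := fun x => r *: c1 x + c2 x.

End Boolean.

(* HC_k(complex 1) ~= HC_k(complex 2) as R-modules, where HC_k = Z_k / B_k:
   an R-linear bijection Z_k/B_k -> Z'_k/B'_k, described (via choice of
   representatives) by a map psi on cycles that is well defined, R-linear,
   injective and surjective modulo boundaries. *)
Definition HC_iso {R : nzRingType} (k : nat)
    {I1 : finType} {G1 : {set I1} -> lmodType R} (g1 : forall S T, G1 T -> G1 S)
    {I2 : finType} {G2 : {set I2} -> lmodType R} (g2 : forall S T, G2 T -> G2 S)
    : Prop :=
  exists psi : chain R I1 G1 -> chain R I2 G2,
    [/\ (forall z, cyc _ _ _ g1 k z -> cyc _ _ _ g2 k (psi z)),
        (forall z1 z2, cyc _ _ _ g1 k z1 -> cyc _ _ _ g1 k z2 ->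
           bnd _ _ _ g1 k (csub _ _ _ z1 z2) -> bnd _ _ _ g2 k (csub _ _ _ (psi z1) (psi z2))),
        (forall (r : R) z1 z2, cyc _ _ _ g1 k z1 -> cyc _ _ _ g1 k z2 ->
           bnd _ _ _ g2 k (csub _ _ _ (psi (clin _ _ _ r z1 z2)) (clin _ _ _ r (psi z1) (psi z2)))),
        (forall z1 z2, cyc _ _ _ g1 k z1 -> cyc _ _ _ g1 k z2 ->
           bnd _ _ _ g2 k (csub _ _ _ (psi z1) (psi z2)) -> bnd _ _ _ g1 k (csub _ _ _ z1 z2)) &
        (forall w, cyc _ _ _ g2 k w -> exists2 z, cyc _ _ _ g1 k z & bnd _ _ _ g2 k (csub _ _ _ (psi z) w))].

Local Close Scope ring_scope.
Local Open Scope order_scope.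

Section Complexes.
Context {disp : Order.disp_t} {L : finTBLatticeType disp} {R : nzRingType}.
Variables (F : L -> lmodType R) (res : forall x y : L, {linear F y -> F x}) (a : L).

(* B^a: elements x of the Boolean cover containing a, identified with subsets
   S = x \ {a} of A \ {a}; the sheaf is F(join of x). *)
Definition jBa (S : {set {b : L | atomb b && (b != a)}}) : L :=
  \join_(y in a |: [set val b | b in S]) y.
Definition G_Ba (S : {set {b : L | atomb b && (b != a)}}) : lmodType R := F (jBa S).
Definition g_Ba (S T : {set {b : L | atomb b && (b != a)}}) : G_Ba T -> G_Ba S :=
  res (jBa S) (jBa T).

(* Boolean cover of L^a = {x >= a}: atoms of L^a are the elements covering a;
   the join in L^a of S is a `|` (join in L of S), and a for S empty. *)
Definition jLa (S : {set {x : L | covers a x}}) : L :=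
  a `|` \join_(x in S) val x.
Definition G_La (S : {set {x : L | covers a x}}) : lmodType R := F (jLa S).
Definition g_La (S T : {set {x : L | covers a x}}) : G_La T -> G_La S :=
  res (jLa S) (jLa T).

End Complexes.

(* Main.v *)
(** Sending an atom [b != a] to the element [a `|` b], which covers [a] by
    semimodularity, is onto the atoms of [L^a]; fix a section [s] of this map.
    Chains of [B^a] supported on subsets of the image [M] of [s] form, up to
    reordering signs, the complex of the Boolean cover of [L^a].  An atom [b]
    outside [M] has a partner [b'] in [M] with [a `|` b = a `|` b'], and
    subtracting from a chain [c] the boundary of its cone with apex [b'] over
    the sets containing [b] removes [b] from the support of [c], as soon as [b]
    is not in the support of the boundary of [c].  Doing this for all [b]
    outside [M] moves cycles, and the chains they bound, into [M]. *)
Require Import Defs.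
From HB Require Import structures.
From mathcomp Require Import all_boot all_order all_algebra.

Set Implicit Arguments.
Unset Strict Implicit.
Unset Printing Implicit Defensive.
Import Order.Theory GRing.Theory.
Local Open Scope ring_scope.

Arguments chain {R I} G.
Arguments bdry {R I G} g c.
Arguments homog {R I G} k c.
Arguments cyc {R I G} g k c.
Arguments bnd {R I G} g k c.
Arguments csub {R I G} c1 c2.
Arguments clin {R I G} r c1 c2.
Arguments eps R {I} x i.

(** * Incidence signs *)

Section Signs.
Variable R : nzRingType.

Lemma scaler_signC (V : lmodType R) (n : nat) (r : R) (v : V) :
  r *: ((-1) ^+ n *: v) = (-1) ^+ n *: (r *: v).
Proof. by rewrite !scalerA commr_sign. Qed.

Lemma scaler_signK (V : lmodType R) (n : nat) (v : V) :
  (-1) ^+ n *: ((-1) ^+ n *: v) = v.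
Proof. by rewrite scalerA -exprD addnn -signr_odd odd_double scale1r. Qed.

Variable I : finType.

Lemma scale_epsK (V : lmodType R) (x : {set I}) (i : I) (v : V) :
  eps R x i *: (eps R x i *: v) = v.
Proof. exact: scaler_signK. Qed.

(** With [i] before [k], inserting [k] leaves the number of elements before [i] unchanged, while
    inserting [i] raises by one the number before [k]. *)
Lemma eps_swap (y : {set I}) (i k : I) :
  i \notin y -> k \notin y -> i != k ->
  eps R (i |: y) i * eps R (k |: (i |: y)) k
  = - (eps R (k |: y) k * eps R (i |: (k |: y)) i).
Proof.
wlog lt_ik : i k / (enum_rank i < enum_rank k)%N.
  move=> W iy ky ik; have [lt|lt|/val_inj/enum_rank_inj eq_ik] :=
    ltngtP (enum_rank i) (enum_rank k).
  - exact: W.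
  - by rewrite (W k i) ?opprK // eq_sym.
  - by rewrite eq_ik eqxx in ik.
move=> iy ky ik; rewrite /eps -!exprD.
set A := [set _ in _ | _]; set B := [set _ in _ | _].
set C := [set _ in _ | _]; set D := [set _ in _ | _].
have -> : A = D.
  apply/setP=> x; rewrite !inE; case: (x =P k) => [->|_] //=.
  by rewrite (negbTE ky) eq_sym (negbTE ik) ltnNge (ltnW lt_ik).
have -> : B = i |: C.
  apply/setP=> x; rewrite !inE.
  by case: (x =P i) => [->|_] /=; rewrite ?orbT ?lt_ik.
have iC : i \notin C by rewrite !inE (negbTE iy) (negbTE ik).
by rewrite cardsU1 iC addnS exprS mulN1r addnC.
Qed.

End Signs.

(** * Signs under a change of order of the atoms *)

Section Reordering.
Variables (R : nzRingType) (K I : finType) (s : K -> I).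
Hypothesis s_inj : injective s.

Definition discordant (x y : K) : bool :=
  (enum_rank x < enum_rank y)%N (+) (enum_rank (s x) < enum_rank (s y))%N.

Lemma discordantC x y : discordant x y = discordant y x.
Proof.
rewrite /discordant; have [->//|nxy] := eqVneq x y.
have ne (J : finType) (u v : J) : u != v ->
    (enum_rank u < enum_rank v)%N = ~~ (enum_rank v < enum_rank u)%N.
  by move=> nuv; case: ltngtP => // /val_inj/enum_rank_inj/eqP; rewrite (negbTE nuv).
by rewrite (ne _ x y) // (ne _ (s x)) ?inj_eq // addbN addNb negbK.
Qed.

(** Each pair is counted once, at its earlier element: this is the inversion number of the
    reordering of [T] caused by [s]. *)
Definition inversions (T : {set K}) : nat :=
  \sum_(x in T) #|[set y in T | (enum_rank x < enum_rank y)%N && discordant x y]|.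

Lemma inversionsU1 (T : {set K}) t : t \notin T ->
  inversions (t |: T) = (#|[set x in T | discordant x t]| + inversions T)%N.
Proof.
move=> tT; rewrite /inversions big_setU1 //=.
(* Those after [t] are counted in the summand of [t]; each one before [t] adds one to its own
   summand. *)
have -> : #|[set x in T | discordant x t]| =
    (#|[set y in t |: T | (enum_rank t < enum_rank y)%N && discordant t y]|
     + \sum_(x in T) ((enum_rank x < enum_rank t)%N && discordant x t))%N.
  rewrite -(cardsID [set y | (enum_rank t < enum_rank y)%N]); congr (_ + _)%N.
    apply: eq_card => y; rewrite !inE (discordantC y t).
    have [->|_] /= := eqVneq y t; first by rewrite (negbTE tT) ltnn.
    by case: (y \in T); case: (enum_rank t < enum_rank y)%N; rewrite ?andbT ?andbF.
  rewrite -big_mkcondr /= sum1_card; apply: eq_card => x.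
  rewrite [in RHS]unfold_in !inE -leqNgt.
  case xT: (x \in T); rewrite ?andbF //= leq_eqVlt.
  have [/val_inj/enum_rank_inj eqx|_] //= := eqVneq (enum_rank x : nat) (enum_rank t).
  by rewrite eqx (negbTE tT) in xT.
rewrite -addnA; congr (_ + _)%N; rewrite -big_split /=.
apply: eq_bigr => x xT.
have xt : x != t by apply: contraNneq tT => <-.
set A := [set _ in t |: T | _]; rewrite (cardsD1 t A) !inE eqxx /=.
congr (_ + _)%N; apply: eq_card => y; rewrite !inE.
by have [->|_] /= := eqVneq y t; rewrite ?(negbTE tT).
Qed.

Definition reorder_sign (T : {set K}) : R := (-1) ^+ inversions T.

(** The elements of [T] before [t] and those whose image precedes [s t] form two sets whose
    symmetric difference consists of the elements discordant with [t], which also give the growth of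
    [inversions]; so the parities agree. *)
Lemma reorder_eps (T : {set K}) t : t \notin T ->
  eps R (t |: T) t * reorder_sign (t |: T)
  = reorder_sign T * eps R (s t |: s @: T) (s t).
Proof.
move=> tT; rewrite /reorder_sign /eps inversionsU1 // -!exprD addnA addnC !exprD.
congr (_ * _); rewrite -exprD.
set A := [set _ in _ | _]; set B := [set _ in _ | _]; set C := [set _ in _ | _].
have -> : #|C| = #|[set x in T | (enum_rank (s x) < enum_rank (s t))%N]|.
  rewrite -(card_imset _ s_inj); apply: eq_card => y; rewrite !inE.
  apply/andP/imsetP => [[/predU1P[->|/imsetP[x xT ->]] lt]|[x]].
  - by rewrite ltnn in lt.
  - by exists x; rewrite // inE xT.
  - by rewrite inE => /andP[xT lt] ->; rewrite imset_f ?orbT.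
set D := [set _ in _ | _].
have -> : A = [set x in T | (enum_rank x < enum_rank t)%N].
  by apply/setP=> x; rewrite !inE; case: (x =P t) => [->|//]; rewrite ltnn !andbF.
set E := [set _ in _ | _].
have -> : B = (E :\: D) :|: (D :\: E).
  apply/setP=> x; rewrite !inE /discordant.
  by case: (x \in T) => //=; do 2!case: (_ < _)%N.
have dis : [disjoint E :\: D & D :\: E].
  rewrite -setI_eq0; apply/eqP/setP=> x; rewrite in_setI !in_setD in_set0;
  by case: (x \in E); case: (x \in D).
move: dis; rewrite -leq_card_setU => /eqP->.
rewrite -(cardsID D E) -(cardsID E D) (setIC D E) -signr_odd -[RHS]signr_odd.
by congr (_ ^+ nat_of_bool _); rewrite !oddD; do 3!case: (odd _).
Qed.

End Reordering.

Section Cellular.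
Context {disp : Order.disp_t} {L : finTBLatticeType disp} {R : nzRingType}.
Variables (F : L -> lmodType R) (res : forall x y : L, {linear F y -> F x}).

(** * Linearity, homogeneity and supports of chains *)

Section Linear.
Variables (I : finType) (j : {set I} -> L).
Let G (S : {set I}) : lmodType R := F (j S).
Let g (S T : {set I}) : G T -> G S := res (j S) (j T).
Implicit Types c : chain G.

Lemma eq_bdry c1 c2 : (forall S, c1 S = c2 S) -> forall y, bdry g c1 y = bdry g c2 y.
Proof. by move=> e y; apply: eq_bigr => i _; rewrite e. Qed.

Lemma bdry_clin r c1 c2 y :
  bdry g (clin r c1 c2) y = r *: bdry g c1 y + bdry g c2 y.
Proof.
rewrite /bdry scaler_sumr -big_split /=; apply: eq_bigr => i _.
by rewrite /g /clin linearP scalerDr scaler_signC.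
Qed.

Lemma csub_clin c1 c2 S : csub c1 c2 S = clin (-1) c2 c1 S.
Proof. by rewrite /csub /clin scaleN1r addrC. Qed.

Lemma bdry_csub c1 c2 y : bdry g (csub c1 c2) y = bdry g c1 y - bdry g c2 y.
Proof. by rewrite (eq_bdry (csub_clin c1 c2)) bdry_clin scaleN1r addrC. Qed.

Lemma homog_clin k r c1 c2 : homog k c1 -> homog k c2 -> homog k (clin r c1 c2).
Proof. by move=> h1 h2 S kS; rewrite /clin h1 ?h2 // scaler0 addr0. Qed.

Lemma homog_csub k c1 c2 : homog k c1 -> homog k c2 -> homog k (csub c1 c2).
Proof. by move=> h1 h2 S kS; rewrite /csub h1 ?h2 // subr0. Qed.

Lemma homog_bdry k c : homog k.+1 c -> homog k (bdry g c).
Proof.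
move=> hc S kS; rewrite /bdry big1 // => i iS.
by rewrite hc ?cardsU1 ?iS ?eqSS // /g linear0 scaler0.
Qed.

Lemma eq_bnd k c1 c2 : (forall S, c1 S = c2 S) -> bnd g k c1 -> bnd g k c2.
Proof. by move=> e [f [hf ef]]; exists f; split=> // y; rewrite -e. Qed.

Lemma bnd_csub k c1 c2 : bnd g k c1 -> bnd g k c2 -> bnd g k (csub c1 c2).
Proof.
move=> [f1 [h1 e1]] [f2 [h2 e2]]; exists (csub f1 f2); split.
  exact: homog_csub.
by move=> y; rewrite bdry_csub -e1 -e2.
Qed.

Definition supported (D : {set I}) c := forall S : {set I}, ~~ (S \subset D) -> c S = 0.

Lemma supported_csub D c1 c2 :
  supported D c1 -> supported D c2 -> supported D (csub c1 c2).
Proof. by move=> h1 h2 S DS; rewrite /csub h1 ?h2 // subr0. Qed.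

Lemma supported_bdry D c : supported D c -> supported D (bdry g c).
Proof.
move=> sc S DS; rewrite /bdry big1 // => i iS.
rewrite sc ?/g ?linear0 ?scaler0 //.
by apply: contra DS; apply: subset_trans; apply: subsetUr.
Qed.

End Linear.

Hypothesis hF : is_sheaf F res.

Lemma res_id x (v : F x) : res x x v = v.
Proof. exact: hF.1. Qed.

Lemma res_comp x y z (v : F z) :
  (x <= y)%O -> (y <= z)%O -> res x y (res y z v) = res x z v.
Proof. exact: hF.2. Qed.

(** * Removing atoms from the support of a chain *)

Section Retraction.
Variables (I : finType) (j : {set I} -> L).
Hypothesis j_homo : forall S T : {set I}, S \subset T -> (j S <= j T)%O.
Let G (S : {set I}) : lmodType R := F (j S).
Let g (S T : {set I}) : G T -> G S := res (j S) (j T).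
Implicit Types c : chain G.

Lemma bdry_bdry c y : bdry g (bdry g c) y = 0.
Proof.
(* [f i k] is the contribution of removing first [k], then [i]. *)
pose f i k : G y := (eps R (i |: y) i * eps R (k |: (i |: y)) k) *:
                    res (j y) (j (k |: (i |: y))) (c (k |: (i |: y))).
pose P i k := [&& i \notin y, k \notin y & i != k].
have -> : bdry g (bdry g c) y = \sum_i \sum_(k | P i k) f i k.
  rewrite /bdry big_mkcond; apply: eq_bigr => i _; rewrite /P.
  case iy: (i \notin y) => /=; last by rewrite big_pred0.
  rewrite /g linear_sum scaler_sumr.
  apply: eq_big => [k|k ky]; first by rewrite !inE negb_or andbC eq_sym.
  rewrite linearZ /= scalerA /f /g res_comp //; apply: j_homo; exact: subsetUr.
have fN i k : P i k -> f i k = - f k i.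
  by case/and3P=> iy ky ik; rewrite /f eps_swap // scaleNr setUCA.
have PC i k : P i k = P k i by rewrite /P andbCA eq_sym.
(* Pairs with [i] before [k] cancel against their swaps. *)
rewrite pair_big_dep /= (bigID (fun u => (enum_rank u.1 < enum_rank u.2)%N)) /=.
rewrite [X in _ + X](reindex_onto (fun u : I * I => (u.2, u.1)) (fun u => (u.2, u.1))) /=;
  last by case.
apply/eqP; rewrite addr_eq0 -sumrN; apply/eqP; apply: eq_big.
  move=> [i k] /=; rewrite eqxx andbT (PC k) -leqNgt [in RHS]leq_eqVlt.
  have [/val_inj/enum_rank_inj->|//] := eqVneq (enum_rank i : nat) (enum_rank k).
  by rewrite /P eqxx !andbF.
by move=> [i k] /= /andP[Pik _]; apply: fN.
Qed.

(* [res (j X) (j (X :\ b'))] goes upwards; it is only meaningful because, under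
   the hypothesis [jb] below, [j X = j (X :\ b')], where it acts as a cast. *)
Definition cone (b b' : I) c : chain G := fun X =>
  if (b \in X) && (b' \in X)
  then eps R X b' *: res (j X) (j (X :\ b')) (c (X :\ b')) else 0.

Definition slide (b b' : I) c : chain G := csub c (bdry g (cone b b' c)).

Lemma eq_slide b b' c1 c2 :
  (forall S, c1 S = c2 S) -> forall S, slide b b' c1 S = slide b b' c2 S.
Proof.
move=> e S; rewrite /slide /csub e; congr (_ - _); apply: eq_bdry => X.
by rewrite /cone e.
Qed.

Lemma slide_clin b b' r c1 c2 S :
  slide b b' (clin r c1 c2) S = clin r (slide b b' c1) (slide b b' c2) S.
Proof.
have e X : cone b b' (clin r c1 c2) X = clin r (cone b b' c1) (cone b b' c2) X.
  rewrite /cone /clin; case: ifP => _; last by rewrite scaler0 addr0.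
  by rewrite linearP scalerDr scaler_signC.
rewrite /slide /csub (eq_bdry e) bdry_clin /clin scalerBr.
by rewrite opprD addrACA.
Qed.

Lemma homog_cone b b' k c : homog k c -> homog k.+1 (cone b b' c).
Proof.
move=> hc X kX; rewrite /cone; case: ifP => // /andP[_ b'X].
by rewrite hc ?linear0 ?scaler0 //; move: kX; rewrite (cardsD1 b' X) b'X eqSS.
Qed.

Lemma bdry_slide b b' c y : bdry g (slide b b' c) y = bdry g c y.
Proof. by rewrite bdry_csub bdry_bdry subr0. Qed.

Section Slide.
Variables b b' : I.
Hypothesis nbb' : b != b'.
Hypothesis jb : forall S : {set I}, b \in S -> j (b' |: S) = j S.

(** Only adding [b'] to [S] reaches a set where the cone can be nonzero, and that term of its
    boundary is [c S] itself. *)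
Lemma slide_out c (S : {set I}) : b \in S -> b' \notin S -> slide b b' c S = 0.
Proof.
move=> bS b'S; rewrite /slide /csub /bdry (bigD1 b') //= big1 ?addr0.
  rewrite /cone !inE eqxx bS orbT /= /g [res _ _ _]linearZ /= scale_epsK.
  rewrite setU1K // (res_comp (c S)) ?jb // ?res_id ?subrr //.
move=> i /andP[iS ib']; rewrite /cone !inE (negbTE b'S) orbF [b' == i]eq_sym.
by rewrite (negbTE ib') andbF /g linear0 scaler0.
Qed.

(** Sets with [b] but not [b'] are settled by [slide_out]. If [S] contains both, the boundary of the
    slide at [S :\ b'] vanishes and its only surviving term is the restriction from [S], an
    isomorphism by [jb]. *)
Lemma supported_slide (D : {set I}) c : b' \in D -> supported D c ->
  supported (D :\ b) (bdry g c) -> supported (D :\ b) (slide b b' c).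
Proof.
move=> b'D sc sb S; rewrite subsetD1 negb_and negbK.
have [SD|nSD _] := boolP (S \subset D); last first.
  rewrite /slide /csub sc // sub0r /bdry big1 ?oppr0 // => i iS.
  (* As [b'] lies in [D], coning does not leave [D]. *)
  rewrite /cone sc; first by rewrite linear0 scaler0 if_same /g linear0 scaler0.
  apply: contra nSD => /subsetP sD; apply/subsetP => x xS.
  have [->//|nxb'] := eqVneq x b'.
  by apply: sD; rewrite !inE nxb' xS orbT.
move=> /= bS; have [b'S|] := boolP (b' \in S); last exact: slide_out.
set e := slide b b' c.
have b'S' : b' \notin S :\ b' by rewrite !inE eqxx.
have bS' : b \in S :\ b' by rewrite !inE nbb'.
have /eqP : bdry g e (S :\ b') = 0.
  by rewrite bdry_slide sb // subsetD1 bS' andbF.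
rewrite /bdry (bigD1 b') //= big1 ?addr0; last first.
  move=> i /andP[iS ib']; rewrite /e slide_out ?/g ?linear0 ?scaler0 //.
    by rewrite inE bS' orbT.
  by rewrite !inE eqxx orbF eq_sym.
rewrite setD1K // => /eqP/(congr1 (fun v => eps R S b' *: v)).
(* The upward map undoes the restriction because [j S = j (S :\ b')]. *)
rewrite scale_epsK scaler0 => /(congr1 (res (j S) (j (S :\ b')))).
have jS : j S = j (S :\ b') by rewrite -(jb bS') setD1K.
by rewrite linear0 /g res_comp ?res_id // jS.
Qed.

End Slide.

Variables (M : {set I}) (f : I -> I).
Hypothesis fM : forall b, b \notin M -> f b \in M.
Hypothesis jf : forall b (S : {set I}), b \notin M -> b \in S -> j (f b |: S) = j S.

Fixpoint slides (l : seq I) c : chain G :=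
  if l is b :: l' then slides l' (slide b (f b) c) else c.

Lemma eq_slides l c1 c2 :
  (forall S, c1 S = c2 S) -> forall S, slides l c1 S = slides l c2 S.
Proof. by elim: l c1 c2 => //= b l IH c1 c2 e; apply/IH/eq_slide. Qed.

Lemma slides_clin l r c1 c2 S :
  slides l (clin r c1 c2) S = clin r (slides l c1) (slides l c2) S.
Proof.
elim: l c1 c2 => //= b l IH c1 c2.
by rewrite -IH; apply: eq_slides => X; apply: slide_clin.
Qed.

Lemma slides_homologous l k c : homog k c -> bnd g k (csub c (slides l c)).
Proof.
elim: l c => [|b l IH] c hc /=.
  exists (fun=> 0); split=> // y; rewrite /csub subrr /bdry big1 // => i _.
  by rewrite /g linear0 scaler0.
have hs := homog_cone b (f b) hc.
have [|e [he ee]] := IH (slide b (f b) c).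
  by apply: homog_csub => //; apply: homog_bdry.
exists (clin 1 (cone b (f b) c) e); split; first exact: homog_clin.
by move=> y; rewrite bdry_clin scale1r -ee /csub addrA /slide /csub addrCA subrr addr0.
Qed.

Lemma bdry_slides l c y : bdry g (slides l c) y = bdry g c y.
Proof. by elim: l c => //= b l IH c; rewrite IH bdry_slide. Qed.

(** Partners lie in [M], so they are never removed from [D]; slides keep the boundary, so its
    support condition persists through the induction. *)
Lemma supported_slides l (D : {set I}) c :
  {subset l <= ~: M} -> M \subset D -> supported D c ->
  supported M (bdry g c) -> supported (D :\: [set x in l]) (slides l c).
Proof.
elim: l D c => [|b l IH] D c lM MD sc sb /=.
  by move=> S DS; apply: sc; apply: contra DS; rewrite set_nil setD0.
have bM : b \notin M by have := lM b (mem_head _ _); rewrite inE.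
have MDb : M \subset D :\ b by rewrite subsetD1 MD bM.
rewrite set_cons -setDDl; apply: IH => //.
- by move=> x xl; apply: lM; rewrite inE xl orbT.
- apply: supported_slide.
  + by apply: contraNneq (bM) => eb; rewrite eb fM.
  + by move=> S; apply: jf.
  + by apply: (subsetP MD); apply: fM.
  + exact: sc.
  + by move=> S DS; apply: sb; apply: contra DS => /subset_trans; apply.
- by move=> S MS; rewrite bdry_slide sb.
Qed.

Lemma homog_slides l k c : homog k c -> homog k (slides l c).
Proof.
by elim: l c => //= b l IH c hc; apply/IH/homog_csub/homog_bdry/homog_cone.
Qed.

Definition retract c : chain G := slides (enum (~: M)) c.

(** Constraining only the boundary lets this apply to cycles and also to chains whose boundary is
    supported in [M]. *)
Lemma supported_retract c : supported M (bdry g c) -> supported M (retract c).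
Proof.
move=> sb S MS; apply: (@supported_slides _ setT) => //.
- by move=> x; rewrite mem_enum.
- by move=> X; rewrite subsetT.
apply: contra MS => /subset_trans; apply; apply/subsetP => x.
by rewrite !inE mem_enum inE negbK andbT.
Qed.

(** * Transport to the Boolean lattice on a set indexing [M] *)

Section Transfer.
Variables (K : finType) (s : K -> I) (jK : {set K} -> L).
Hypothesis s_inj : injective s.
Hypothesis defM : M = s @: [set: K].
Hypothesis jKE : forall T : {set K}, jK T = j (s @: T).
Let GK (T : {set K}) : lmodType R := F (jK T).
Let gK (S T : {set K}) : GK T -> GK S := res (jK S) (jK T).
Implicit Types w : chain GK.

(** By [jKE] the [res] factor is a cast between equal modules; [reorder_sign] corrects for the
    different orders on [K] and [I]. *)
Definition pull c : chain GK := fun T =>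
  reorder_sign R s T *: res (jK T) (j (s @: T)) (c (s @: T)).

Definition push w : chain G := fun S =>
  if S \subset M
  then reorder_sign R s (s @^-1: S) *: res (j S) (jK (s @^-1: S)) (w (s @^-1: S))
  else 0.

Lemma preimset_imset (T : {set K}) : s @^-1: (s @: T) = T.
Proof. by apply/setP=> x; rewrite inE mem_imset. Qed.

Lemma imset_preimset (S : {set I}) : S \subset M -> s @: (s @^-1: S) = S.
Proof.
rewrite defM => /subsetP SM; apply/setP=> x; apply/imsetP/idP.
  by case=> y; rewrite inE => ? ->.
by move=> xS; have /imsetP[y _ xy] := SM x xS; exists y; rewrite // inE -xy.
Qed.

Lemma imset_subM (T : {set K}) : s @: T \subset M.
Proof. by rewrite defM imsetS. Qed.

Lemma pull_push w T : pull (push w) T = w T.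
Proof.
rewrite /pull /push imset_subM preimset_imset [res _ _ _]linearZ /= scaler_signK.
by rewrite res_comp ?jKE // res_id.
Qed.

Lemma push_pull c : supported M c -> forall S, push (pull c) S = c S.
Proof.
move=> sc S; rewrite /push /pull; case: ifP => [SM|/negbT/sc//].
rewrite [res _ _ _]linearZ /= scaler_signK res_comp ?jKE imset_preimset //.
exact: res_id.
Qed.

Lemma supported_push w : supported M (push w).
Proof. by move=> S /negbTE nSM; rewrite /push nSM. Qed.

(** Terms adding a point outside [M] vanish by support; the others are indexed by [K] through [s],
    and [reorder_eps] matches the signs. *)
Lemma pull_bdry c : supported M c -> forall T, pull (bdry g c) T = bdry gK (pull c) T.
Proof.
move=> sc T; rewrite /pull /bdry linear_sum scaler_sumr.
rewrite (bigID [in M]) /= [X in _ + X]big1 ?addr0; last first.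
  move=> i /andP[_ iM]; rewrite sc ?/g ?linear0 ?scaler0 ?linear0 ?scaler0 //.
  by apply: contra iM => /subsetP; apply; rewrite setU11.
(* [pick] gives the partial inverse of [s], defined on its image. *)
rewrite (reindex_omap s (fun i => [pick t | s t == i])) /=; last first.
  move=> i /andP[_]; rewrite defM => /imsetP[t _ ->] /=.
  by case: pickP => [u /eqP<-//|/(_ t)]; rewrite eqxx.
apply: eq_big => [t|t].
  rewrite mem_imset // defM imset_f // andbT; case: pickP => [u /eqP/s_inj->|/(_ t)].
    by rewrite eqxx andbT.
  by rewrite eqxx.
rewrite mem_imset // => /andP[/andP[tT _] _].
rewrite /gK /g [res _ _ (_ *: _)]linearZ /= [res _ _ (_ *: _)]linearZ /=.
rewrite !scalerA (reorder_eps R s_inj tT) imsetU1 !res_comp ?jKE ?imsetU1 //;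
  by apply: j_homo; apply: subsetUr.
Qed.

(** [push] inverts [pull] on chains supported in [M], so this follows from [pull_bdry]. *)
Lemma bdry_push w S : bdry g (push w) S = push (bdry gK w) S.
Proof.
rewrite -(push_pull (supported_bdry (supported_push w))) /push.
case: ifP => // _; congr (_ *: res _ _ _); rewrite pull_bdry; last exact: supported_push.
by apply: eq_bdry => T; apply: pull_push.
Qed.

Lemma homog_pull k c : homog k c -> homog k (pull c).
Proof. by move=> hc T kT; rewrite /pull hc ?card_imset // linear0 scaler0. Qed.

Lemma homog_push k w : homog k w -> homog k (push w).
Proof.
move=> hw S kS; rewrite /push; case: ifP => // SM.
by rewrite hw ?linear0 ?scaler0 // -(card_imset _ s_inj) imset_preimset.
Qed.

Lemma pull_csub c1 c2 T : pull (csub c1 c2) T = csub (pull c1) (pull c2) T.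
Proof. by rewrite /pull /csub linearB scalerBr. Qed.

(** A chain bounding [c] may leave [M]; its retract stays in [M] and has the same boundary. *)
Lemma bnd_pull k c : supported M c -> bnd g k c -> bnd gK k (pull c).
Proof.
move=> sc [e [he ee]].
have se : supported M (bdry g e) by move=> S MS; rewrite -ee sc.
have sr := supported_retract se.
exists (pull (retract e)); split.
  by apply: homog_pull; apply: homog_slides.
move=> T; rewrite -pull_bdry // /pull; congr (_ *: res _ _ _).
by rewrite ee bdry_slides.
Qed.

Lemma bnd_push k w : bnd gK k w -> bnd g k (push w).
Proof.
move=> [e [he ee]]; exists (push e); split; first exact: homog_push.
by move=> S; rewrite bdry_push /push ee.
Qed.

Lemma supported_cyc_retract k z : cyc g k z -> supported M (retract z).
Proof. by case=> _ bz; apply: supported_retract => S _; apply: bz. Qed.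

(** Each cycle differs from its retract by a boundary. *)
Lemma bnd_csub_retract k z1 z2 : cyc g k z1 -> cyc g k z2 ->
  bnd g k (csub z1 z2) <-> bnd g k (csub (retract z1) (retract z2)).
Proof.
move=> [h1 _] [h2 _].
have b1 := slides_homologous (enum (~: M)) h1.
have b2 := slides_homologous (enum (~: M)) h2.
split=> b.
  apply: eq_bnd (bnd_csub b (bnd_csub b1 b2)) => S; rewrite /csub.
  by rewrite opprB addrA subrKA opprB addrC subrKA.
apply: eq_bnd (bnd_csub b1 (bnd_csub b2 b)) => S; rewrite /csub.
by rewrite opprB opprB subrKA subrKA.
Qed.

Lemma HC_iso_pull_retract k : HC_iso k g gK.
Proof.
exists (fun z => pull (retract z)); split.
- move=> z cz; have [hz bz] := cz; split.
    by apply: homog_pull; apply: homog_slides.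
  move=> T; rewrite -pull_bdry; last exact: supported_cyc_retract cz.
  by rewrite /pull bdry_slides bz linear0 scaler0.
- move=> z1 z2 c1 c2 /(bnd_csub_retract c1 c2) b12.
  apply: eq_bnd (fun T => pull_csub _ _ T) _; apply: bnd_pull => //.
  by apply: supported_csub; [exact: supported_cyc_retract c1|exact: supported_cyc_retract c2].
(* [pull] and [retract] are linear on chains, so the zero chain bounds the defect. *)
- move=> r z1 z2 _ _; exists (fun=> 0); split=> // T.
  rewrite /bdry big1 => [|i _]; last by rewrite /gK linear0 scaler0.
  rewrite /csub /pull /retract slides_clin /clin linearP scalerDr scaler_signC subrr //.
- move=> z1 z2 c1 c2 b12; apply/(bnd_csub_retract c1 c2).
  apply: eq_bnd (bnd_push b12) => S.
  have s12 : supported M (csub (retract z1) (retract z2)).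
    by apply: supported_csub; [exact: supported_cyc_retract c1|exact: supported_cyc_retract c2].
  by rewrite -[RHS](push_pull s12) /push pull_csub.
(* Surjectivity: [push w] is homologous to its retract, and [pull] recovers [w] from it. *)
move=> w [hw bw]; have hp := homog_push hw.
have cp : cyc g k (push w).
  split=> // S; rewrite bdry_push /push bw linear0 scaler0; exact: if_same.
exists (push w) => //.
have [||e [he ee]] := @bnd_pull k (csub (push w) (retract (push w))).
- apply: supported_csub; first exact: supported_push.
  exact: supported_cyc_retract cp.
- exact: slides_homologous.
(* [e] bounds [w] minus the image of [push w]; the opposite difference is required, hence the factor
   -1. *)
exists (clin (-1) e (fun=> 0)); split.
  by apply: homog_clin.
move=> T; rewrite bdry_clin -ee pull_csub /csub pull_push.
rewrite /bdry big1 => [|i _]; last by rewrite /gK linear0 scaler0.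
by rewrite addr0 scaleN1r opprB.
Qed.

End Transfer.

End Retraction.
End Cellular.

(** * Atoms and covers in a geometric lattice *)

Section Geometry.
Context {disp : Order.disp_t} {L : finTBLatticeType disp}.
Variables (rk : L -> nat) (hgeo : geometric rk).
Local Open Scope order_scope.

(** Rank is prescribed along covers only. Induction on the number of elements strictly between [x]
    and [y]: an intermediate [z] splits the interval into two that omit [z]. *)
Lemma rk_lt (x y : L) : x < y -> (rk x < rk y)%N.
Proof.
have [_ hcov _ _] := hgeo.
have [n] := ubnP #|[set z | x < z < y]|.
elim: n x y => // n IH x y; rewrite ltnS => le_n xy.
have [cxy|] := boolP (covers x y); first by rewrite (hcov _ _ cxy).
rewrite /covers xy /= negb_forall => /existsP[z]; rewrite negbK => /andP[xz zy].
have lt_n (A : {set L}) : A \subset [set z | x < z < y] -> z \notin A -> (#|A| < n)%N.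
  move=> sA zA; apply: leq_trans le_n; apply: proper_card.
  by apply/properP; split=> //; exists z; rewrite ?inE ?xz.
apply: ltn_trans (IH x z _ xz) (IH z y _ zy); apply: lt_n.
- apply/subsetP=> u; rewrite !inE => /andP[-> /lt_trans]; exact.
- by rewrite inE ltxx andbF.
- by apply/subsetP=> u; rewrite !inE => /andP[/(lt_trans xz)-> ->].
- by rewrite inE ltxx.
Qed.

Lemma atom_not_le (a b : L) : atomb a -> atomb b -> b != a -> ~~ (b <= a).
Proof.
move=> /andP[_ /forallP ha] /andP[hb _] nba; apply/negP => le_ba.
by have := ha b; rewrite hb lt_neqAle nba le_ba.
Qed.

(** Semimodularity bounds the rank of the join by 2, leaving no room strictly between it and [a], of
    rank 1. *)
Lemma covers_join_atoms (a b : L) :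
  atomb a -> atomb b -> b != a -> covers a (a `|` b).
Proof.
have [rk0 hcov _ smod] := hgeo.
move=> ha hb nba; have lt_a : a < a `|` b.
  rewrite lt_neqAle leUl andbT eq_sym; apply/negP=> /eqP e.
  by have := atom_not_le ha hb nba; rewrite -e leUr.
rewrite /covers lt_a /=; apply/forallP=> z; apply/negP => /andP[/rk_lt az /rk_lt zab].
have := smod a b; rewrite (hcov _ _ ha) (hcov _ _ hb) rk0.
rewrite (hcov _ _ ha) rk0 in az.
by move/(leq_trans (leq_addr _ _))/(leq_trans (leq_ltn_trans az zab)).
Qed.

(** Some atom below [x] is not below [a], as [x] is the join of the atoms below it. Its join with
    [a] is strictly above [a] and at most [x], hence equals [x]. *)
Lemma exists_atom_join (a x : L) : covers a x ->
  exists b, [&& atomb b, b != a & a `|` b == x].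
Proof.
have [_ _ hat _] := hgeo.
case/andP=> ax /forallP hx.
have [b /andP[/andP[hb bx] nba]] :
    exists b, (atomb b && (b <= x)) && ~~ (b <= a).
  apply/existsP; apply: contraFT (lt_geF ax); rewrite negb_exists => /forallP h.
  rewrite (hat x); apply/joinsP => b hb.
  by have := h b; rewrite hb negbK.
exists b; rewrite hb (_ : b != a) /=; last by apply: contraNneq nba => ->.
have := hx (a `|` b); rewrite lt_neqAle leUl andbT lt_neqAle leUx (ltW ax) bx !andbT.
rewrite negb_and !negbK => /orP[/eqP e|//].
by rewrite e leUr in nba.
Qed.

Variable a : L.

Lemma jBaE (S : {set {b : L | atomb b && (b != a)}}) :
  jBa a S = a `|` \join_(b in S) val b.
Proof.
apply/eqP; rewrite eq_le /jBa; apply/andP; split.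
  apply/joinsP => x; rewrite in_setU1 => /predU1P[->|/imsetP[b bS ->]].
    exact: leUl.
  by apply: lexUr; apply: joins_sup.
rewrite leUx (joins_sup id)  /= ?setU11 //; apply/joinsP => b bS.
by apply: (joins_sup id); rewrite in_setU1 imset_f ?orbT.
Qed.

End Geometry.

Theorem theorem6 (disp : Order.disp_t) (L : finTBLatticeType disp)
  (rk : L -> nat) (hgeo : geometric rk)
  (R : nzRingType) (F : L -> lmodType R)
  (res : forall x y : L, {linear F y -> F x}) (hF : is_sheaf F res)
  (a : L) (ha : atomb a) (i : nat) :
  HC_iso i (g_Ba F res a) (g_La F res a).
Proof.
pose J := {b : L | atomb b && (b != a)}; pose K := {x : L | covers a x}.
have ex_s (x : K) : exists b : J, (a `|` val b)%O == val x.
  have [b /and3P[hb nba e]] := exists_atom_join hgeo (valP x).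
  by exists (Sub b (introT andP (conj hb nba))); rewrite SubK.
pose s (x : K) : J := xchoose (ex_s x).
have sE x : (a `|` val (s x))%O = val x by apply/eqP/(xchooseP (ex_s x)).
have q_cov (b : J) : covers a (a `|` val b)%O.
  by have /andP[hb nba] := valP b; apply: (covers_join_atoms hgeo).
pose q (b : J) : K := Sub _ (q_cov b).
have qE (b : J) : (a `|` val (s (q b)))%O = (a `|` val b)%O by rewrite sE SubK.
(* The partner of [b] is the chosen atom [s (q b)], which has the same join with [a]. *)
apply: (@HC_iso_pull_retract _ L R F res hF J (jBa a) _ (s @: [set: K])
          (s \o q) _ _ K s (jLa a)) => //.
- move=> S T /subsetP sST; rewrite !jBaE leUx leUl /=.
  by apply/joinsP => b /sST bT; apply: lexUr; apply: joins_sup.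
- by move=> b _; apply: imset_f.
(* [s (q b)] lies below the join of [a] and [b], so adding it to a set containing [b] keeps the
   join. *)
- move=> b S _ bS; rewrite !jBaE; apply/eqP; rewrite eq_le !leUx !leUl /=.
  apply/andP; split; apply/joinsP => c.
    rewrite in_setU1 => /predU1P[->|cS]; last by apply: lexUr; apply: joins_sup.
    apply: (@le_trans _ _ (a `|` val b)%O); first by rewrite -qE leUr.
    by rewrite leUx leUl /=; apply: lexUr; apply: joins_sup.
  by move=> cS; apply: lexUr; apply: joins_sup; rewrite in_setU1 cS orbT.
(* [x] is recovered from [s x] as its join with [a]. *)
- by move=> x y e; apply: val_inj; rewrite -!sE e.
- move=> T; rewrite jBaE /jLa; apply/eqP; rewrite eq_le !leUx !leUl /=.
  apply/andP; split; apply/joinsP.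
    move=> x xT; rewrite -sE leUx leUl /=.
    by apply: lexUr; apply: joins_sup; apply: imset_f.
  move=> _ /imsetP[x xT ->]; apply: lexUr.
  apply: (@le_trans _ _ (val x)); first by rewrite -sE leUr.
  exact: (joins_sup val).
Qed.
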